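(* Let $K$ be a field, $H_K$ a finite-dimensional $K$-vector space, $H^\lambda_K=H_K\otimes_K K[\lambda]$, and let $g^\lambda:H^\lambda_K\times H^\lambda_K\to K[\lambda,\lambda^{-1}]$ be a localized $K[\lambda]$-metric on $H^\lambda_K$. Let $I_\bullet=(I_k)_{k\in\mathbb{Z}}$ and $g_\bullet=(g_k)_{k\in\mathbb{Z}}$ be the subspaces of $H_K$ and the bilinear forms on the quotients $I_k/I_{k-1}$ induced from $g^\lambda$. Then $(I_\bullet,g_\bullet)$ is a nondegenerate filtration on $H_K$.
   Context: A localized $K[\lambda]$-metric on $H^\lambda_K$ is a symmetric $K[\lambda]$-bilinear form $g^\lambda:H^\lambda_K\times H^\lambda_K\to K[\lambda,\lambda^{-1}]$ which is unimodular over $K[\lambda,\lambda^{-1}]$, i.e. its Gram matrix in a $K[\lambda]$-basis of $H^\lambda_K$ is invertible over $K[\lambda,\lambda^{-1}]$. Identify $H_K$ with $H^\lambda_K/\lambda H^\lambda_K$ and let $\pi:H^\lambda_K\to H_K$ be the projection. For $k\in\mathbb{Z}$ set $$I_k^\lambda=\{\boldsymbol{x}\in H^\lambda_K\mid \lambda^k g^\lambda(\boldsymbol{x},\boldsymbol{y})\in K[\lambda]\ \text{for all } \boldsymbol{y}\in H^\lambda_K\},\qquad I_k=\pi(I_k^\lambda)\subset H_K .$$ The bilinear form $g_k$ on $I_k/I_{k-1}$ is $$g_k(\bar x,\bar y)=\mathrm{Res}_{\lambda=0}\,\lambda^{k-1}g^\lambda(\boldsymbol{x},\boldsymbol{y})\qquad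 (x,y\in I_k),$$ where $\bar x$ denotes the class of $x$ modulo $I_{k-1}$, $\boldsymbol{x},\boldsymbol{y}\in I_k^\lambda$ are any lifts of $x,y$ (the right side does not depend on the choices), and $\mathrm{Res}_{\lambda=0}$ takes the coefficient of $\lambda^{-1}$. A metric on a $K$-vector space is a nondegenerate symmetric bilinear form. A nondegenerate filtration on a finite-dimensional $K$-vector space $V$ is a pair $(I_\bullet,g_\bullet)$ consisting of an exhaustive increasing filtration of $V$ by subspaces ($I_{k-1}\subset I_k$ for all $k\in\mathbb{Z}$, $I_k=V$ for $k\gg0$, $I_k=0$ for $k\ll0$) and a metric $g_k$ on $I_k/I_{k-1}$ for each $k$. *)

(* Defs.v *)
From HB Require Import structures.
From mathcomp Require Import all_boot all_order all_algebra.
From mathcomp Require Import generic_quotient ring_quotient.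
From mathcomp Require Import boolp functions.
From mathcomp Require Import zify.

Set Implicit Arguments.
Unset Strict Implicit.
Unset Printing Implicit Defensive.

Import Order.TTheory GRing.Theory Num.Theory.
Local Open Scope ring_scope.
Local Open Scope quotient_scope.

Local Notation "x %:F" := (FracField.tofrac x).

(** * The ring K[λ, λ^-1], as the subring of K(λ) of the fractions p / λ^n *)

Section Laurent.
Variable K : fieldType.

Definition laurent_pred : {pred {fraction {poly K}}} :=
  fun f => `[< exists n (p : {poly K}), 'X^n%:F * f = p%:F >].

Lemma laurent_subring : subring_closed laurent_pred.
Proof.
split=> [|f g /asboolP[n [p fp]] /asboolP[m [q gq]]
         |f g /asboolP[n [p fp]] /asboolP[m [q gq]]]; apply/asboolP.
- by exists 0%N, 1; rewrite mulr1 expr0.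
- exists (n + m)%N, ('X^m * p - 'X^n * q).
  rewrite exprD tofracB !tofracM -fp -gq mulrBr.
  by rewrite [X in X * f]mulrC -!mulrA.
- exists (n + m)%N, (p * q).
  by rewrite exprD !tofracM -fp -gq mulrACA.
Qed.

HB.instance Definition _ :=
  GRing.isSubringClosed.Build _ laurent_pred laurent_subring.

Record laurent := Laurent {
  lval : {fraction {poly K}};
  lvalP : lval \in laurent_pred }.

HB.instance Definition _ := [isSub for lval].
HB.instance Definition _ := [Choice of laurent by <:].
HB.instance Definition _ := [SubChoice_isSubComNzRing of laurent by <:].

Lemma lvalM f g : lval (f * g) = lval f * lval g. Proof. by []. Qed.
Lemma lvalB f g : lval (f - g) = lval f - lval g. Proof. by []. Qed.
Lemma lval1 : lval 1 = 1. Proof. by []. Qed.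

Definition lunit : pred laurent :=
  fun f => (lval f != 0) && ((lval f)^-1 \in laurent_pred).
Definition linv (f : laurent) : laurent :=
  if lunit f then insubd f (lval f)^-1 else f.

Lemma lmulVf : {in lunit, left_inverse 1 linv *%R}.
Proof.
move=> f uf; rewrite /linv (uf : lunit f); apply: val_inj.
by case/andP: uf => f0 Lf; change (val (insubd f (lval f)^-1) * lval f = 1); rewrite insubdK // mulVf.
Qed.

Lemma lunitPl f g : g * f = 1 -> lunit f.
Proof.
move/(congr1 lval); rewrite lvalM lval1 => gf1.
have f0 : lval f != 0.
  by apply: contra_eq_neq gf1 => ->; rewrite mulr0 eq_sym oner_eq0.
apply/andP; split=> //.
by rewrite -[_^-1]mul1r -gf1 mulfK // lvalP.
Qed.

Lemma linv_out : {in [predC lunit], linv =1 id}.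
Proof. by move=> f /negbTE uf; rewrite /linv; move: uf; rewrite /in_mem/= => ->. Qed.

HB.instance Definition _ :=
  GRing.ComNzRing_hasMulInverse.Build laurent lmulVf lunitPl linv_out.

Lemma polyL_subproof (p : {poly K}) : p%:F \in laurent_pred.
Proof. by apply/asboolP; exists 0%N, p; rewrite expr0 mul1r. Qed.

(* the inclusion of K[λ] in K[λ, λ^-1] *)
Definition polyL (p : {poly K}) : laurent := Laurent (polyL_subproof p).

Lemma polyL_zmod : zmod_morphism polyL.
Proof. by move=> p q; apply: val_inj; rewrite raddfB /= tofracB. Qed.
Lemma polyL_monoid : monoid_morphism polyL.
Proof.
by split=> [|p q]; apply: val_inj; rewrite ?rmorph1 ?rmorphM /= ?tofrac1 ?tofracM.
Qed.
HB.instance Definition _ := GRing.isZmodMorphism.Build _ _ polyL polyL_zmod.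
HB.instance Definition _ := GRing.isMonoidMorphism.Build _ _ polyL polyL_monoid.

Definition lscale (p : {poly K}) (f : laurent) : laurent := polyL p * f.

Lemma lscaleA p q f : lscale p (lscale q f) = lscale (p * q) f.
Proof. by rewrite /lscale mulrA rmorphM. Qed.
Lemma lscale1 : left_id 1 lscale.
Proof. by move=> f; rewrite /lscale rmorph1 mul1r. Qed.
Lemma lscaleDr : right_distributive lscale +%R.
Proof. by move=> p f g; rewrite /lscale mulrDr. Qed.
Lemma lscaleDl f : {morph lscale^~ f : p q / p + q}.
Proof. by move=> p q; rewrite /lscale rmorphD mulrDl. Qed.

HB.instance Definition _ := GRing.Zmodule_isLmodule.Build {poly K} laurent
  lscaleA lscale1 lscaleDr lscaleDl.

Lemma lscaleE (p : {poly K}) (f : laurent) : p *: f = polyL p * f.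
Proof. by []. Qed.

Definition lam : laurent := polyL 'X.

Lemma lam_unit : lam \is a GRing.unit.
Proof.
apply/andP; split; first by rewrite tofrac_eq0 polyX_eq0.
apply/asboolP; exists 1%N, 1.
by rewrite expr1 tofrac1 mulfV // tofrac_eq0 polyX_eq0.
Qed.

Lemma lnumP (f : laurent) :
  exists np : nat * {poly K}, 'X^(np.1)%:F * lval f = np.2%:F.
Proof. by case/asboolP: (lvalP f) => n [p e]; exists (n, p). Qed.

(* the coefficient of λ^m: it is that of λ^(m + n) in p if f = p / λ^n *)
Definition lcoef (f : laurent) (m : int) : K :=
  let np := sval (cid (lnumP f)) in
  if m + np.1%:Z is Posz j then np.2`_j else 0.

Lemma lcoefE (f : laurent) (n : nat) (p : {poly K}) (m : int) :
  'X^n%:F * lval f = p%:F -> lcoef f m = if m + n%:Z is Posz j then p`_j else 0.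
Proof.
rewrite /lcoef; case: cid => -[n' p'] /= e' e.
have/eqP : ('X^n * p')%:F = ('X^n' * p)%:F by rewrite !tofracM -e' -e mulrCA.
rewrite tofrac_eq => /eqP epp.
have cE (k : nat) (q : {poly K}) (i : int) :
  (if i is Posz j then q`_j else 0) =
  (if i + k%:Z is Posz j then ('X^k * q)`_j else 0).
  case: i => [j|j]; first by rewrite -PoszD coefXnM ltnNge leq_addl /= addnK.
  case E: (Negz j + k%:Z) => [l|//]; rewrite coefXnM ifT //.
  by rewrite NegzE in E; lia.
by rewrite (cE n) [RHS](cE n') epp addrAC.
Qed.

Lemma lcoefB (m : int) : zmod_morphism (lcoef^~ m).
Proof.
move=> f g; have [[n p] /= ef] := lnumP f; have [[n' q] /= eg] := lnumP g.
have Ef : 'X^(n + n')%:F * lval f = ('X^n' * p)%:F.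
  by rewrite exprD !tofracM -ef mulrCA mulrA.
have Eg : 'X^(n + n')%:F * lval g = ('X^n * q)%:F.
  by rewrite exprD !tofracM -eg mulrA.
have Efg : 'X^(n + n')%:F * lval (f - g) = ('X^n' * p - 'X^n * q)%:F.
  by rewrite lvalB mulrBr Ef Eg tofracB.
rewrite (lcoefE _ Ef) (lcoefE _ Eg) (lcoefE _ Efg).
by case: (m + _) => j; rewrite ?coefB ?subr0.
Qed.

Definition lres (f : laurent) : K := lcoef f (-1).

Definition is_polyL (f : laurent) : Prop := exists p : {poly K}, f = polyL p.

Lemma lres_polyL (f : laurent) : is_polyL f -> lres f = 0.
Proof. by case=> p ->; rewrite /lres (@lcoefE _ 0 p) // expr0 tofrac1 mul1r. Qed.

End Laurent.

(** * The K[λ]-module H ⊗ K[λ], as the polynomials in λ with coefficients in H *)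

Section PolyModule.
Variables (K : fieldType) (H : lmodType K).

Definition finsupp : {pred nat -> H} :=
  fun x => `[< exists n, forall i, (n <= i)%N -> x i = 0 >].

Lemma finsupp_zmod : zmod_closed finsupp.
Proof.
split=> [|x y /asboolP[n xn] /asboolP[m ym]]; apply/asboolP.
  by exists 0%N.
exists (maxn n m) => i; rewrite geq_max => /andP[ni mi].
by rewrite !fctE xn // ym // subr0.
Qed.

HB.instance Definition _ := GRing.isZmodClosed.Build _ finsupp finsupp_zmod.

Record polymod := Polymod {
  pcoef : nat -> H;
  pcoefP : pcoef \in finsupp }.

HB.instance Definition _ := [isSub for pcoef].
HB.instance Definition _ := [Choice of polymod by <:].
HB.instance Definition _ := [SubChoice_isSubZmodule of polymod by <:].

Definition pscale_fun (p : {poly K}) (x : nat -> H) (i : nat) : H :=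
  \sum_(j < i.+1) p`_j *: x (i - j)%N.

Lemma pscale_subproof (p : {poly K}) (x : polymod) :
  pscale_fun p (pcoef x) \in finsupp.
Proof.
case: x => x /= /asboolP[n xn]; apply/asboolP; exists (size p + n)%N => i le_i.
apply: big1 => j _; have [pj|jp] := leqP (size p) j.
  by rewrite nth_default ?scale0r.
by rewrite xn ?scaler0 //; lia.
Qed.

Definition pscale (p : {poly K}) (x : polymod) : polymod :=
  Polymod (pscale_subproof p x).

Lemma polymodP (x y : polymod) : pcoef x =1 pcoef y -> x = y.
Proof. by move=> e; apply: val_inj; apply/funext. Qed.

Lemma pcoefD (x y : polymod) i : pcoef (x + y) i = pcoef x i + pcoef y i.
Proof. by []. Qed.
Lemma pcoefB (x y : polymod) i : pcoef (x - y) i = pcoef x i - pcoef y i.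
Proof. by []. Qed.
Lemma pcoef0 i : pcoef 0 i = 0.
Proof. by []. Qed.

Lemma pscaleA p q x : pscale p (pscale q x) = pscale (p * q) x.
Proof.
apply: polymodP => i /=; rewrite /pscale_fun /=.
under eq_bigr do rewrite scaler_sumr.
under [RHS]eq_bigr do rewrite coefM scaler_suml.
pose F j k := (p`_j * q`_(k - j)) *: pcoef x (i - k)%N.
transitivity (\sum_(j < i.+1) \sum_(k < i.+1 | (j <= k)%N) F j k); last first.
  rewrite (exchange_big_dep predT) //=; apply: eq_bigr => k _.
  rewrite (big_ord_narrow_leq (leq_ord k)) /=.
  by apply: eq_bigr => j _; rewrite /F.
apply: eq_bigr => j _.
rewrite -(big_mkord (fun k => (j <= k)%N) (F j)) (@big_cat_nat _ _ _ j) ?(ltnW (ltn_ord j)) //=.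
rewrite [X in _ = X + _]big_nat_cond [X in _ = X + _]big_pred0; last first.
  by move=> k; rewrite ltnNge andbC; case: (j <= k)%N.
rewrite add0r.
rewrite -[X in \sum_(X <= _ < _ | _) _]add0n big_addn subSn ?leq_ord // big_mkord.
rewrite [RHS](eq_bigl predT); last by move=> k /=; rewrite leq_addl.
apply: eq_bigr => k _; rewrite /F addnK scalerA; congr (_ *: pcoef x _).
by lia.
Qed.

Lemma pscale1 : left_id 1 pscale.
Proof.
move=> x; apply: polymodP => i /=; rewrite /pscale_fun big_ord_recl subn0.
by rewrite coef1 scale1r big1 ?addr0 // => j _; rewrite coef1 scale0r.
Qed.

Lemma pscaleDr : right_distributive pscale +%R.
Proof.
move=> p x y; apply: polymodP => i; rewrite pcoefD /= /pscale_fun -big_split /=.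
by apply: eq_bigr => j _; rewrite -scalerDr.
Qed.

Lemma pscaleDl x : {morph pscale^~ x : p q / p + q}.
Proof.
move=> p q; apply: polymodP => i; rewrite pcoefD /= /pscale_fun -big_split /=.
by apply: eq_bigr => j _; rewrite coefD scalerDl.
Qed.

HB.instance Definition _ := GRing.Zmodule_isLmodule.Build {poly K} polymod
  pscaleA pscale1 pscaleDr pscaleDl.

Lemma pcoefZ (p : {poly K}) (x : polymod) i :
  pcoef (p *: x) i = \sum_(j < i.+1) p`_j *: pcoef x (i - j)%N.
Proof. by []. Qed.

Lemma tens_subproof (v : H) (p : {poly K}) : (fun i => p`_i *: v) \in finsupp.
Proof.
by apply/asboolP; exists (size p) => i le_i; rewrite nth_default ?scale0r.
Qed.

(* the pure tensor v ⊗ p *)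
Definition tens (v : H) (p : {poly K}) : polymod := Polymod (tens_subproof v p).

Lemma tensE v p : tens v p = p *: tens v 1.
Proof.
apply: polymodP => i; rewrite pcoefZ big_ord_recr /= subnn coef1 scale1r.
by rewrite big1 ?add0r // => j _; rewrite coef1 subn_eq0 leqNgt ltn_ord scale0r scaler0.
Qed.

(* the identification of H with H ⊗ K[λ] / λ (H ⊗ K[λ]) sends the class of x
   to its constant coefficient *)
Definition proj (x : polymod) : H := pcoef x 0%N.

Lemma proj_surj (v : H) : proj (tens v 1) = v.
Proof. by rewrite /proj /= coef1 scale1r. Qed.

Lemma proj_ker (x : polymod) : proj x = 0 <-> exists y, x = 'X *: y.
Proof.
split=> [x0|[y ->]]; last first.
  by rewrite /proj pcoefZ big_ord1 coefX scale0r.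
have sy : (fun i => pcoef x i.+1) \in finsupp.
  case/asboolP: (pcoefP x) => n xn; apply/asboolP; exists n => i ni.
  by rewrite xn // ltnW.
exists (Polymod sy); apply: polymodP => -[|i].
  by rewrite pcoefZ big_ord1 coefX scale0r.
rewrite pcoefZ big_ord_recl big_ord_recl /= !coefX scale0r add0r scale1r.
by rewrite subSS subn0 big1 ?addr0 // => j _; rewrite coefX scale0r.
Qed.

Lemma projZ p x : proj (p *: x) = p`_0 *: proj x.
Proof. by rewrite /proj pcoefZ big_ord1. Qed.

Lemma projB : zmod_morphism proj.
Proof. by []. Qed.
HB.instance Definition _ := GRing.isZmodMorphism.Build polymod H proj projB.

Lemma polymod_sum (x : polymod) n : (forall i, (n <= i)%N -> pcoef x i = 0) ->
  x = \sum_(i < n) 'X^i *: tens (pcoef x i) 1.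
Proof.
move=> xn; apply: polymodP => i.
have -> : pcoef (\sum_(j < n) 'X^j *: tens (pcoef x j) 1) i =
          \sum_(j < n) pcoef (tens (pcoef x j) 'X^j) i.
  under eq_bigr do rewrite -tensE.
  by elim/big_rec2: _ => [//|j a b _ <-]; rewrite pcoefD.
have [ni|ltin] := leqP n i.
  rewrite xn // big1 // => j _ /=; rewrite coefXn gtn_eqF ?scale0r //.
  exact: leq_trans ni.
rewrite (bigD1 (Ordinal ltin)) //= coefXn eqxx scale1r big1 ?addr0 // => j ji.
rewrite coefXn; case: eqP => [e|]; rewrite ?scale0r //.
by case/eqP: ji; apply: val_inj.
Qed.

(* polymod is the extension of scalars of H from K to K[λ]: a K-linear map to a
   K[λ]-module M extends uniquely to a K[λ]-linear map on polymod *)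
Lemma tens_univ (M : lmodType {poly K}) (f : H -> M) :
    (forall c u v, f (c *: u + v) = c%:P *: f u + f v) ->
  (exists F : {linear polymod -> M}, forall v, F (tens v 1) = f v) /\
  (forall F G : {linear polymod -> M},
     (forall v, F (tens v 1) = G (tens v 1)) -> F =1 G).
Proof.
move=> f_lin; split; last first.
  move=> F G FG x; case/asboolP: (pcoefP x) => n xn.
  rewrite [x](polymod_sum xn) !linear_sum; apply: eq_bigr => i _.
  by rewrite !linearZ /= FG.
have f0 : f 0 = 0.
  have := f_lin (-1) 0 0; rewrite scaler0 addr0 => {1}->.
  by rewrite polyCN polyC1 scaleN1r addNr.
have fD u v : f (u + v) = f u + f v by have := f_lin 1 u v; rewrite !scale1r.
have fZ c u : f (c *: u) = c%:P *: f u.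
  by have := f_lin c u 0; rewrite f0 !addr0.
have bnd x : exists n, forall i, (n <= i)%N -> pcoef x i = 0.
  by case/asboolP: (pcoefP x) => n xn; exists n.
pose F x := \sum_(i < sval (cid (bnd x))) 'X^i *: f (pcoef x i).
have FE x n : (forall i, (n <= i)%N -> pcoef x i = 0) ->
    F x = \sum_(i < n) 'X^i *: f (pcoef x i).
  move=> xn; rewrite /F; case: cid => m /= xm.
  have ext a b : (forall i, (a <= i)%N -> pcoef x i = 0) -> (a <= b)%N ->
      \sum_(i < a) 'X^i *: f (pcoef x i) = \sum_(i < b) 'X^i *: f (pcoef x i).
    move=> xa ab; rewrite -!(big_mkord predT (fun i => 'X^i *: f (pcoef x i))).
    rewrite (big_cat_nat (leq0n a) ab) /= [X in _ + X]big_nat_cond.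
    rewrite [X in _ + X]big1 ?addr0 // => i /andP[/andP[ai _] _].
    by rewrite xa // f0 scaler0.
  by case: (leqP m n) => [|/ltnW] mn; [apply: ext|apply/esym/ext].
have FD x y : F (x + y) = F x + F y.
  have [n xn] := bnd x; have [m ym] := bnd y.
  rewrite (FE x (n + m)%N) => [|i ni]; last by apply: xn; lia.
  rewrite (FE y (n + m)%N) => [|i ni]; last by apply: ym; lia.
  rewrite (FE _ (n + m)%N) => [|i ni]; last by rewrite pcoefD xn ?ym ?addr0 //; lia.
  by rewrite -big_split; apply: eq_bigr => i _; rewrite pcoefD fD scalerDr.
have FC c x : F (c%:P *: x) = c%:P *: F x.
  have cE i : pcoef (c%:P *: x) i = c *: pcoef x i.
    rewrite pcoefZ big_ord_recl coefC /= subn0 big1 ?addr0 // => j _.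
    by rewrite coefC scale0r.
  have [n xn] := bnd x; rewrite (FE x n) // (FE _ n) => [|i ni]; last first.
    by rewrite cE xn ?scaler0.
  rewrite scaler_sumr; apply: eq_bigr => i _.
  by rewrite cE fZ !scalerA mulrC.
have FX x : F ('X *: x) = 'X *: F x.
  have X0 : pcoef ('X *: x) 0 = 0 by rewrite pcoefZ big_ord1 coefX scale0r.
  have XS i : pcoef ('X *: x) i.+1 = pcoef x i.
    rewrite pcoefZ big_ord_recl big_ord_recl /= !coefX scale0r add0r scale1r.
    by rewrite subSS subn0 big1 ?addr0 // => j _; rewrite coefX scale0r.
  have [n xn] := bnd x; rewrite (FE x n) // (FE _ n.+1) => [|[|i] ni //]; last first.
    by rewrite XS xn.
  rewrite big_ord_recl X0 f0 scaler0 add0r scaler_sumr.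
  by apply: eq_bigr => i _; rewrite XS scalerA -exprS.
have F_lin : linear F.
  move=> p x y; rewrite FD; congr (_ + _).
  elim/poly_ind: p x => [|p c IH] x.
    by rewrite !scale0r; have := FD 0 0; rewrite addr0 => /eqP;
       rewrite -subr_eq0 opprD addNKr oppr_eq0 => /eqP.
  by rewrite !scalerDl FD FC -!scalerA IH FX.
pose mF := GRing.isLinear.Build {poly K} polymod M _ F F_lin.
pose F' : {linear polymod -> M} := HB.pack F mF.
exists F' => v; rewrite [LHS](FE _ 1%N) => [|i i0].
  by rewrite big_ord1 expr0 scale1r /= coef1 scale1r.
by rewrite /= coef1 eqn0Ngt i0 scale0r.
Qed.

End PolyModule.

Section QuotientSpace.
Variables (K : fieldType) (V : vectType K).

Definition subvs_in (U W : {vspace V}) : {pred subvs_of U} :=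
  fun u => vsval u \in W.

Lemma subvs_in_zmod U W : zmod_closed (@subvs_in U W).
Proof.
split=> [|u v uW vW]; rewrite /in_mem /= /subvs_in ?linear0 ?mem0v //.
by rewrite linearB rpredB.
Qed.
HB.instance Definition _ U W :=
  GRing.isZmodClosed.Build _ (@subvs_in U W) (subvs_in_zmod U W).

(* U / W, for W a subspace of U; without this assumption, U / (U ∩ W) *)
Definition vquot (U W : {vspace V}) : Type := Quotient.quot (@subvs_in U W).

HB.instance Definition _ U W := Choice.on (vquot U W).
HB.instance Definition _ U W := GRing.Zmodule.on (vquot U W).

(* the class of a vector of U (meaningless outside of U) *)
Definition vclass (U W : {vspace V}) (v : V) : vquot U W :=
  \pi_(Quotient.quot (@subvs_in U W)) (vsproj U v).

Section Scale.
Variables (U W : {vspace V}).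

Lemma vclassB : {in U &, {morph @vclass U W : u v / u - v}}.
Proof. by move=> u v uU vU; rewrite /vclass linearB [LHS]raddfB. Qed.

Lemma vclass_eq u v : u \in U -> v \in U ->
  (@vclass U W u = @vclass U W v) <-> (u - v \in W).
Proof.
move=> uU vU; rewrite /vclass; split=> [/eqP|uvW].
  rewrite -Quotient.idealrBE /in_mem /= /subvs_in linearB /=.
  by rewrite !vsprojK.
apply/eqP; rewrite -Quotient.idealrBE /in_mem /= /subvs_in linearB /=.
by rewrite !vsprojK.
Qed.

Lemma vclass_surj (X : vquot U W) : exists2 u, u \in U & X = vclass U W u.
Proof.
exists (vsval (repr X)); first exact: subvsP.
by rewrite /vclass vsvalK reprK.
Qed.

Definition vqscale (a : K) (X : vquot U W) : vquot U W :=
  vclass U W (a *: vsval (repr X)).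

Lemma vqscaleE a u : u \in U -> vqscale a (vclass U W u) = vclass U W (a *: u).
Proof.
move=> uU; apply/vclass_eq; rewrite ?rpredZ ?subvsP //.
rewrite -scalerBr rpredZ //; apply/vclass_eq; rewrite ?subvsP //.
by rewrite /vclass vsvalK reprK.
Qed.

Lemma vclassD : {in U &, {morph @vclass U W : u v / u + v}}.
Proof. by move=> u v uU vU; rewrite /vclass linearD [LHS]raddfD. Qed.

Lemma vqscaleA a b X : vqscale a (vqscale b X) = vqscale (a * b) X.
Proof.
have [u uU ->] := vclass_surj X.
by rewrite !vqscaleE ?rpredZ // scalerA.
Qed.
Lemma vqscale1 : left_id 1 vqscale.
Proof. by move=> X; have [u uU ->] := vclass_surj X; rewrite vqscaleE // scale1r. Qed.
Lemma vqscaleDr : right_distributive vqscale +%R.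
Proof.
move=> a X Y; have [u uU ->] := vclass_surj X; have [v vU ->] := vclass_surj Y.
by rewrite -vclassD // !vqscaleE ?rpredD // scalerDr vclassD // rpredZ.
Qed.
Lemma vqscaleDl X : {morph vqscale^~ X : a b / a + b}.
Proof.
move=> a b; have [u uU ->] := vclass_surj X.
by rewrite !vqscaleE // scalerDl vclassD // rpredZ.
Qed.

HB.instance Definition _ := GRing.Zmodule_isLmodule.Build K (vquot U W)
  vqscaleA vqscale1 vqscaleDr vqscaleDl.
End Scale.

Lemma vspace_of_pred (P : V -> Prop) :
    P 0 -> (forall a u v, P u -> P v -> P (a *: u + v)) ->
  exists U : {vspace V}, forall v, v \in U <-> P v.
Proof.
move=> P0 PD.
pose Q d := `[< exists U : {vspace V}, (forall v, v \in U -> P v) /\ \dim U = d >].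
have exQ : exists d, Q d.
  exists 0%N; apply/asboolP; exists 0%VS; split; last exact: dimv0.
  by move=> v; rewrite memv0 => /eqP ->.
have bQ d : Q d -> (d <= \dim {:V})%N.
  by case/asboolP => U [_ <-]; rewrite dimvS ?subvf.
case: (ex_maxnP exQ bQ) => d /asboolP[U [UP <-]] maxU.
exists U => v; split=> [/UP //|Pv].
have UvP : forall w, w \in (<[v]> + U)%VS -> P w.
  by move=> w /memv_addP[_ /vlineP[a ->] [u uU ->]]; apply: PD => //; apply: UP.
have le_d : (\dim (<[v]> + U) <= \dim U)%N.
  by apply: maxU; apply/asboolP; exists (<[v]> + U)%VS.
have /eqP -> : U == (<[v]> + U)%VS by rewrite eqEdim addvSr le_d.
by rewrite memvE addvSl.
Qed.

Definition is_metric (Q : lmodType K) (b : Q -> Q -> K) : Prop :=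
  [/\ (forall y, scalar (b^~ y)) /\ (forall x, scalar (b x)),
      forall x y, b x y = b y x
    & forall x, (forall y, b x y = 0) -> x = 0].

Record nondegenerate_filtration (I : int -> {vspace V})
    (b : forall k, vquot (I k) (I (k - 1)) -> vquot (I k) (I (k - 1)) -> K) :
    Prop := NondegenerateFiltration {
  filt_increasing : forall k, (I (k - 1) <= I k)%VS;
  filt_full : exists N : int, forall k, N <= k -> I k = fullv;
  filt_zero : exists N : int, forall k, k <= N -> I k = 0%VS;
  filt_metric : forall k, is_metric (b k) }.

End QuotientSpace.

Definition is_basis (R : nzRingType) (M : lmodType R) (n : nat) (e : 'I_n -> M) :
    Prop :=
  forall x, exists! c : 'rV[R]_n, x = \sum_i c 0 i *: e i.

Section LocalizedMetric.
Variables (K : fieldType) (H : vectType K).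

Record localized_metric := LocalizedMetric {
  lm_form :> {bilinear polymod H -> polymod H -> laurent K};
  lm_sym : forall x y, lm_form x y = lm_form y x;
  lm_unimodular : exists n (e : 'I_n -> polymod H),
    is_basis e /\ (\matrix_(i, j) lm_form (e i) (e j)) \in unitmx }.

Variable g : localized_metric.

(* I_k^λ; being in K[λ] is `is_polyL` *)
Definition Ilam (k : int) (x : polymod H) : Prop :=
  forall y, is_polyL (lam K ^ k * g x y).

Lemma is_polyLD (f h : laurent K) : is_polyL f -> is_polyL h -> is_polyL (f + h).
Proof. by move=> [p ->] [q ->]; exists (p + q); rewrite rmorphD. Qed.
Lemma is_polyLM p (f : laurent K) : is_polyL f -> is_polyL (polyL p * f).
Proof. by move=> [q ->]; exists (p * q); rewrite rmorphM. Qed.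

Lemma Ilam0 k : Ilam k 0.
Proof. by move=> y; exists 0; rewrite linear0l mulr0 rmorph0. Qed.

Lemma IlamP k p x y : Ilam k x -> Ilam k y -> Ilam k (p *: x + y).
Proof.
move=> xk yk z; rewrite linearPl mulrDr; apply: is_polyLD => //.
by rewrite lscaleE mulrCA; apply: is_polyLM.
Qed.

Lemma Ilam_pred k x : Ilam (k - 1) x -> Ilam k x.
Proof.
move=> xk y; have -> : lam K ^ k = polyL 'X * lam K ^ (k - 1).
  by rewrite -[polyL 'X]/(lam K ^ 1) -exprzDr ?lam_unit // addrC subrK.
by rewrite -mulrA; apply: is_polyLM.
Qed.

Lemma Ifil_subproof k :
  exists U : {vspace H}, forall v, v \in U <-> exists2 x, Ilam k x & v = proj x.
Proof.
apply: vspace_of_pred => [|a _ _ [x xk ->] [y yk ->]].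
  by exists 0; rewrite ?raddf0 //; apply: Ilam0.
exists (a%:P *: x + y); first exact: IlamP.
by rewrite [RHS]raddfD; congr (_ + _); rewrite [RHS]projZ coefC.
Qed.

(* I_k = π(I_k^λ) *)
Definition Ifil (k : int) : {vspace H} := sval (cid (Ifil_subproof k)).

Lemma IfilP k v : v \in Ifil k <-> exists2 x, Ilam k x & v = proj x.
Proof. exact: (svalP (cid (Ifil_subproof k))). Qed.

Definition grquot (k : int) := vquot (Ifil k) (Ifil (k - 1)).
Definition grclass (k : int) (x : polymod H) : grquot k :=
  vclass (Ifil k) (Ifil (k - 1)) (proj x).

Lemma grlift_subproof k (X : grquot k) : exists x, Ilam k x /\ X = grclass k x.
Proof.
by have [v /IfilP[x xk ->] ->] := vclass_surj X; exists x.
Qed.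

Definition grlift k (X : grquot k) : polymod H := sval (cid (grlift_subproof X)).

(* g_k, computed on chosen lifts; gr_formE shows that any lifts give the same value *)
Definition gr_form (k : int) (X Y : vquot (Ifil k) (Ifil (k - 1))) : K :=
  lres (lam K ^ (k - 1) * g (grlift X) (grlift Y)).

Lemma lres_congr k x x' y : Ilam k x -> Ilam k x' -> Ilam k y ->
    grclass k x = grclass k x' ->
  lres (lam K ^ (k - 1) * g x y) = lres (lam K ^ (k - 1) * g x' y).
Proof.
move=> xk x'k yk.
have inI z : Ilam k z -> proj z \in Ifil k by move=> zk; apply/IfilP; exists z.
move=> /(vclass_eq _ (inI _ xk) (inI _ x'k)) /IfilP[a ak].
rewrite -raddfB => /eqP; rewrite -subr_eq0 -raddfB => /eqP /proj_ker[b eb].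
have -> : x = x' + (a + 'X *: b).
  by rewrite -eb [a + _]addrC subrK addrC subrK.
rewrite linearDl mulrDr; apply/eqP; rewrite -subr_eq0 /lres -lcoefB addrAC subrr.
rewrite add0r; apply/eqP/lres_polyL; rewrite linearDl mulrDr.
apply: is_polyLD => //; rewrite linearZl_LR lscaleE mulrA.
have -> : lam K ^ (k - 1) * polyL 'X = lam K ^ k.
  by rewrite -[polyL 'X]/(lam K ^ 1) -exprzDr ?lam_unit // subrK.
by rewrite lm_sym.
Qed.

Lemma gr_formE k x y : Ilam k x -> Ilam k y ->
  gr_form (grclass k x) (grclass k y) = lres (lam K ^ (k - 1) * g x y).
Proof.
move=> xk yk; rewrite /gr_form /grlift; case: cid => x' [x'k ex] /=.
case: cid => y' [y'k ey] /=; rewrite (lres_congr x'k xk) // lm_sym.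
by rewrite (lres_congr y'k yk) // lm_sym.
Qed.

End LocalizedMetric.

Arguments nondegenerate_filtration {K V} I b.
Arguments Ifil {K H} g k.
Arguments gr_form {K H} g k X Y.

(* Main.v *)
(** Let [L] be the module and [T] the matrix of [λ^k g^λ].  Since [T] and its
    inverse have bounded poles, [I_k] is everything for large [k] and zero for
    small [k].  Nondegeneracy of [g_k] is a double annihilator statement over
    [K[λ]/λ^m], a Frobenius algebra through the functional "coefficient of
    [λ^(m-1)]": a vector [x] of [I_k^λ] whose pairing with [I_k^λ] has no
    residue lies in the sum of [λ L] and the dual of [L] for [λ^(k-1) g^λ], so
    that [x] agrees modulo [λ] with a vector of [I_(k-1)^λ]. *)

From HB Require Import structures.
Require Import Defs.
From mathcomp Require Import all_boot all_order all_algebra.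
From mathcomp Require Import boolp.
From mathcomp Require Import zify.

Set Implicit Arguments.
Unset Strict Implicit.
Unset Printing Implicit Defensive.

Import Order.TTheory GRing.Theory Num.Theory.
Local Open Scope ring_scope.

(** * Duality for row spaces of polynomial matrices modulo a power of ['X] *)

Lemma vspace_separation (K : fieldType) m n (U : {vspace 'M[K]_(m, n)})
    (v : 'M[K]_(m, n)) :
  v \notin U -> exists f : {scalar 'M[K]_(m, n)}, f v != 0 /\ {in U, f =1 fun=> 0}.
Proof.
move=> vU; pose h (z : 'M[K]_(m, n)) := z - projv U z.
have : h v != 0.
  by apply: contraNneq vU => /eqP; rewrite subr_eq0 => /eqP ->; apply: memv_proj.
case/matrix0Pn => i [j hij].
have h_lin : scalar (fun z => h z i j).
  by move=> a x y; rewrite /h linearP !mxE /=; rewrite mulrBr opprD addrACA.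
pose mh := GRing.isLinear.Build K _ _ _ (fun z => h z i j) h_lin.
pose f : {scalar 'M[K]_(m, n)} := HB.pack (fun z => h z i j) mh.
exists f; split=> // z zU; rewrite -[f z]/(h z i j) /h projv_id // subrr.
by rewrite mxE.
Qed.

(** If [w] modulo ['X^m] were outside the truncated row space of [R], a functional would separate it
    from that space. Such a functional is the coefficient of ['X^m.-1] in the product with some
    column [u]. As the row space is stable under ['X], [R *m u] vanishes modulo ['X^m], which
    contradicts the hypothesis on [w]. *)
Lemma poly_double_annihilator (K : fieldType) (m r n : nat)
    (R : 'M[{poly K}]_(r, n)) (w : 'rV[{poly K}]_n) :
    (forall (u : 'cV_n) (d : 'cV_r),
       R *m u = 'X^m *: d -> ((w *m u) 0 0)`_m.-1 = 0) ->
  exists (b : 'rV_n) (a : 'rV_r), w = 'X^m *: b + a *m R.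
Proof.
case: m => [|m] Hw; first by exists w, 0; rewrite mul0mx addr0 expr0 scale1r.
pose trunc (z : 'rV[{poly K}]_n) : 'M[K]_(m.+1, n) := \matrix_(i, j) (z 0 j)`_i.
have truncB z z' : trunc (z - z') = trunc z - trunc z'.
  by apply/matrixP => i j; rewrite !mxE coefB.
have truncP c z z' : trunc (c%:P *: z + z') = c *: trunc z + trunc z'.
  by apply/matrixP => i j; rewrite !mxE coefD coefCM.
have trunc0 z : trunc z = 0 -> exists b : 'rV_n, z = 'X^(m.+1) *: b.
  move=> z0; exists (\row_j \poly_(i < size (z 0 j)) (z 0 j)`_(i + m.+1)).
  apply/rowP => j; rewrite !mxE; apply/polyP => i; rewrite coefXnM.
  case: ltnP => [lti|lei].
    by have /matrixP/(_ (Ordinal lti) j) := z0; rewrite !mxE.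
  by rewrite coef_poly subnK //; case: ltnP => // le;
     rewrite nth_default ?(leq_trans le) ?leq_subr.
have [U UP] : exists U : {vspace 'M[K]_(m.+1, n)},
    forall M, M \in U <-> exists a, M = trunc (a *m R).
  apply: vspace_of_pred => [|c _ _ [a ->] [a' ->]].
    by exists 0; apply/matrixP => i j; rewrite mul0mx !mxE coef0.
  by exists (c%:P *: a + a'); rewrite mulmxDl -scalemxAl truncP.
have [/UP[a ea]|wU] := boolP (trunc w \in U).
  have [|b eb] := trunc0 (w - a *m R); first by rewrite truncB ea subrr.
  by exists b, a; rewrite -eb subrK.
have [f [fw fU]] := vspace_separation wU.
(* The exponents are reversed so that the coefficient of ['X^m] in [z *m u] pairs the coefficient
   [i] of [z] with the value of [f] at [delta_mx i j]. *)
pose u : 'cV[{poly K}]_n :=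
  \col_j \sum_(i < m.+1) (f (delta_mx i j))%:P * 'X^(m - i).
have fE (z : 'rV[{poly K}]_n) : ((z *m u) 0 0)`_m = f (trunc z).
  rewrite [trunc z]matrix_sum_delta exchange_big linear_sum mxE coef_sum.
  apply: eq_bigr => j _.
  rewrite mxE mulr_sumr coef_sum linear_sum; apply: eq_bigr => i _.
  rewrite linearZ /= mxE mulrCA coefCM coefMXn ltnNge leq_subr /=.
  by rewrite subKn ?leq_ord // mulrC.
suff [d ed] : exists d : 'cV_r, R *m u = 'X^(m.+1) *: d.
  by case/eqP: fw; rewrite -fE; apply: Hw ed.
set q := R *m u; exists (\col_j \poly_(i < size (q j 0)) (q j 0)`_(i + m.+1)).
apply/colP => j; rewrite [RHS]mxE [X in _ * X]mxE; apply/polyP => i.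
rewrite coefXnM; case: ltnP => [lti|lei]; last first.
  by rewrite coef_poly subnK //; case: ltnP => // le;
     rewrite nth_default ?(leq_trans le) ?leq_subr.
(* Shifting row [j] of [R] by ['X^(m - i)] moves the coefficient [i] of [q j 0] to position [m],
   where [f] reads it; the shifted row is still in the row space, so [f] kills it. *)
have := fE ('X^(m - i) *: (delta_mx 0 j *m R)).
rewrite fU; last by apply/UP; exists ('X^(m - i) *: delta_mx 0 j); rewrite -scalemxAl.
rewrite -scalemxAl -mulmxA -rowE -/q mxE [row _ _ _ _]mxE coefXnM.
by rewrite ltnNge leq_subr /= subKn.
Qed.

(** * Clearing denominators and computing residues *)

Section Laurent.
Variable K : fieldType.
Implicit Types f h : laurent K.

Lemma polyL_inj : injective (@polyL K).
Proof. by move=> p q /(congr1 (@lval K)) /eqP; rewrite /= tofrac_eq => /eqP. Qed.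

Lemma polyLXn n : polyL 'X^n = lam K ^+ n.
Proof. by rewrite rmorphXn. Qed.

Lemma lamD (k l : int) : lam K ^ (k + l) = lam K ^ k * lam K ^ l.
Proof. by rewrite exprzDr // lam_unit. Qed.

Lemma is_polyL_lam_mul f : exists n : nat, is_polyL (lam K ^+ n * f).
Proof.
have [[n p] /= e] := lnumP f; exists n, p; rewrite -polyLXn.
exact: val_inj.
Qed.

Lemma map_mx_polyL_lam m n (A : 'M[laurent K]_(m, n)) :
  exists (N : nat) (B : 'M[{poly K}]_(m, n)),
    lam K ^+ N *: A = map_mx (@polyL K) B.
Proof.
have [N HN] := choice (fun ij => is_polyL_lam_mul (A ij.1 ij.2)).
have [p Hp] := choice HN.
pose M := (\max_ij N ij)%N.
exists M, (\matrix_(i, j) ('X^(M - N (i, j)) * p (i, j))).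
apply/matrixP => i j; rewrite !mxE rmorphM /= -Hp polyLXn mulrA -exprD subnK //.
exact: leq_bigmax.
Qed.

Lemma lres_polyLV (p : {poly K}) : lres (lam K ^ (-1 : int) * polyL p) = p`_0.
Proof.
rewrite /lres (@lcoefE _ _ 1%N p) // -[FracField.tofrac 'X^1]/(lval (polyL 'X)).
by rewrite -lvalM -[polyL 'X]/(lam K) mulrA mulrV ?lam_unit // mul1r.
Qed.

Lemma lresB : zmod_morphism (@lres K).
Proof. exact: lcoefB. Qed.
HB.instance Definition _ := GRing.isZmodMorphism.Build _ _ (@lres K) lresB.

Lemma lresC c f : lres (polyL c%:P * f) = c * lres f.
Proof.
have [[n p] /= e] := lnumP f; rewrite /lres (lcoefE _ e).
rewrite (@lcoefE _ _ n (c%:P * p)).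
  by case: (-1 + _) => j; rewrite ?coefCM ?mulr0.
by rewrite lvalM mulrCA e tofracM.
Qed.

End Laurent.

(** * The filtration and its forms in coordinates *)

Section NondegenerateFiltration.
Variables (K : fieldType) (H : vectType K) (g : localized_metric H).
Variables (n : nat) (e : 'I_n -> polymod H).
Hypothesis e_basis : is_basis e.

Local Notation L := (map_mx (@polyL K)).
Let gram : 'M[laurent K]_n := \matrix_(i, j) g (e i) (e j).

Let elt (c : 'rV[{poly K}]_n) := \sum_i c 0 i *: e i.

Let eltP x : exists c, x = elt c.
Proof. by have [c [xc _]] := e_basis x; exists c. Qed.

Let eltB c d : elt (c - d) = elt c - elt d.
Proof. by rewrite /elt -sumrB; apply: eq_bigr => i _; rewrite !mxE scalerBl. Qed.

Let eltZ p c : elt (p *: c) = p *: elt c.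
Proof. by rewrite /elt scaler_sumr; apply: eq_bigr => i _; rewrite mxE scalerA. Qed.

Let gE (c d : 'rV_n) : g (elt c) (elt d) = (L c *m gram *m (L d)^T) 0 0.
Proof.
rewrite linear_sumr mxE; apply: eq_bigr => j _.
rewrite linearZr_LR linear_sumlz lscaleE !mxE mulrC; congr (_ * _).
by apply: eq_bigr => i _; rewrite linearZl_LR lscaleE !mxE.
Qed.

Let gram_tr : gram^T = gram.
Proof. by apply/matrixP => i j; rewrite !mxE lm_sym. Qed.

Let L_inj m r : injective (map_mx (@polyL K) : 'M_(m, r) -> _).
Proof.
move=> A B /matrixP eAB; apply/matrixP => i j; apply: polyL_inj.
by have := eAB i j; rewrite !mxE.
Qed.

(** By linearity in the second argument it is enough to pair with the basis vectors, which are the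
    [elt (delta_mx 0 j)]. *)
Lemma Ilam_elt k c :
  Ilam g k (elt c) <-> exists p, lam K ^ k *: (L c *m gram) = L p.
Proof.
split=> [ck|[p ep] y]; last first.
  have [d ->] := eltP y; rewrite gE.
  exists ((p *m d^T) 0 0); have := congr1 (fun A => (A *m (L d)^T) 0 0) ep.
  by rewrite -scalemxAl mxE map_trmx -map_mxM mxE [RHS]mxE.
have [p Hp] := choice (fun j => ck (elt (delta_mx 0 j))).
exists (\row_j p j); apply/rowP => j; rewrite !mxE -Hp gE.
by rewrite map_delta_mx trmx_delta -colE !mxE.
Qed.

Lemma Ifil_full : exists N : int, forall k, N <= k -> Ifil g k = fullv.
Proof.
have [N [B eB]] := map_mx_polyL_lam gram; exists N%:Z => k leNk.
have [j ->] : exists j : nat, k = j%:Z + N%:Z by exists `|k - N%:Z|%N; lia.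
apply/eqP; rewrite eqEsubv subvf; apply/subvP => v _; apply/IfilP.
exists (tens v 1); last by rewrite proj_surj.
have [c ->] := eltP (tens v 1); apply/Ilam_elt; exists ('X^j *: (c *m B)).
by rewrite map_mxZ map_mxM -eB /= lamD polyLXn -scalerA -scalemxAr.
Qed.

Hypothesis gram_unit : gram \in unitmx.

Lemma Ifil_zero : exists N : int, forall k, k <= N -> Ifil g k = 0%VS.
Proof.
have [N [B eB]] := map_mx_polyL_lam (invmx gram).
(* [N] powers of λ clear the denominators of [invmx gram]; the one left over makes [c] divisible by
   λ, so that [proj] kills it. *)
exists (- N.+1%:Z) => k lekN; apply/eqP; rewrite -subv0; apply/subvP => v.
case/IfilP=> x + ->; have [c ->] := eltP x; case/Ilam_elt => p ep.
rewrite memv0; apply/eqP.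
have [j ej] : exists j : nat, - k = j.+1%:Z + N%:Z.
  by exists `|- k - N.+1%:Z|%N; lia.
suff -> : c = 'X^(j.+1) *: (p *m B) by rewrite eltZ projZ coefXn scale0r.
have lam_jNk : lam K ^+ j.+1 * lam K ^+ N * lam K ^ k = 1.
  by rewrite !exprnP -!lamD -ej addNr.
apply: L_inj; rewrite map_mxZ map_mxM -eB -ep -scalemxAl -scalemxAr /= polyLXn.
by rewrite mulmxK // !scalerA mulrAC lam_jNk scale1r.
Qed.

Lemma Ilam_nondegenerate k x : Ilam g k x ->
    (forall y, Ilam g k y -> lres (lam K ^ (k - 1) * g x y) = 0) ->
  proj x \in Ifil g (k - 1).
Proof.
have [c ->] := eltP x => _ c_orth.
pose T := lam K ^ k *: gram; pose S := lam K ^ (- k) *: invmx gram.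
have TS : T *m S = 1%:M.
  by rewrite -scalemxAl -scalemxAr scalerA -lamD subrr scale1r mulmxV.
have ST : S *m T = 1%:M by apply: mulmx1C.
have [N [B eB]] := map_mx_polyL_lam S.
(* [R *m u] is divisible by ['X^N.+1] exactly when [S *m L u] is polynomial. The rows of [R],
   divided by λ^N, are those of [lam K *: S], which span the dual of the lattice for λ^(k-1) g. *)
pose R := 'X *: B.
have eR : L R = lam K ^+ N.+1 *: S by rewrite map_mxZ -eB scalerA exprS.
have lamK (m r m' : nat) (A A' : 'M_(m, r)) :
  lam K ^+ m' *: A = lam K ^+ m' *: A' -> A = A'.
  have u : lam K ^+ m' \is a GRing.unit by rewrite unitrX ?lam_unit.
  move=> /(congr1 ( *:%R (lam K ^+ m')^-1)).
  by rewrite !scalerA mulVr // !scale1r.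
(* The factor ['X^N] turns the coefficient of ['X^N] into the constant coefficient of [c *m u],
   which is the residue of λ^(k-1) g at [elt c] and [elt d^T]. *)
have [|b [a eba]] := @poly_double_annihilator K N.+1 n n R ('X^N *: c).
  move=> u d eRu; have eSu : S *m L u = L d.
    apply: (lamK _ _ N.+1).
    by rewrite scalemxAl -eR -map_mxM eRu map_mxZ /= polyLXn.
  have eu : L u = T *m L d by rewrite -eSu mulmxA TS mul1mx.
  rewrite -scalemxAl mxE coefXnM ltnn subnn -lres_polyLV.
  have dk : Ilam g k (elt d^T).
    apply/Ilam_elt; exists u^T; rewrite -!map_trmx eu /T trmx_mul linearZ /=.
    by rewrite gram_tr scalemxAr.
  have := c_orth _ dk; rewrite gE -map_trmx trmxK => <-; congr lres.
  suff -> : polyL ((c *m u) 0 0) = lam K ^ k * (L c *m gram *m L d) 0 0.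
    by rewrite mulrA -lamD [k - 1]addrC.
  have -> : polyL ((c *m u) 0 0) = (L c *m L u) 0 0 by rewrite -map_mxM [RHS]mxE.
  by rewrite eu /T -scalemxAl -scalemxAr mulmxA mxE.
(* Dividing [eba] by λ^N gives [L c' = lam K *: (L a *m S)], a vector of the dual that agrees with
   [c] modulo λ. *)
pose c' := c - 'X *: b.
have ec' : lam K ^+ N *: L c' = lam K ^+ N *: (lam K *: (L a *m S)).
  rewrite scalerA -exprSr scalemxAr -eR -map_mxM -polyLXn -map_mxZ; congr (L _).
  by rewrite /c' scalerBr eba scalerA -exprSr addrAC subrr add0r.
apply/IfilP; exists (elt c').
  apply/Ilam_elt; exists a; rewrite (lamK _ _ _ _ _ ec') -scalemxAl scalerA.
  have -> : lam K ^ (k - 1) * lam K = lam K ^ k.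
    by rewrite -[X in _ * X]/(lam K ^ 1) -lamD subrK.
  by rewrite -mulmxA !scalemxAr -/T ST mulmx1.
by rewrite /c' eltB eltZ [RHS]raddfB [X in _ - X]projZ coefX scale0r subr0.
Qed.

End NondegenerateFiltration.

(** * Linearity on lifts, and the four conditions *)

Lemma grclassP (K : fieldType) (H : vectType K) (g : localized_metric H) k c x y :
    Ilam g k x -> Ilam g k y ->
  grclass g k (c%:P *: x + y) = c *: grclass g k x + grclass g k y.
Proof.
have inI z : Ilam g k z -> proj z \in Ifil g k by move=> zk; apply/IfilP; exists z.
move=> xk yk; have xI := inI _ xk; have yI := inI _ yk.
have -> : grclass g k (c%:P *: x + y) =
    vclass (Ifil g k) (Ifil g (k - 1)) (c *: proj x + proj y).
  by congr vclass; rewrite [LHS]raddfD [X in X + _]projZ coefC.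
by rewrite vclassD ?rpredZ // -vqscaleE.
Qed.

Theorem lemma3p4 (K : fieldType) (H : vectType K) (g : localized_metric H) :
  nondegenerate_filtration (Ifil g) (gr_form g).
Proof.
have [n [e [e_basis gram_unit]]] := lm_unimodular g.
have gr_sym k X Y : gr_form g k X Y = gr_form g k Y X by rewrite /gr_form lm_sym.
(* The chosen lift of a combination need not be the combination of the chosen lifts, so [gr_formE]
   is used to change lifts. *)
have gr_lin k Y : scalar ((gr_form g k)^~ Y).
  move=> c X X'; have [y [yk ->]] := grlift_subproof Y.
  have [x [xk ->]] := grlift_subproof X; have [x' [x'k ->]] := grlift_subproof X'.
  rewrite -grclassP // !gr_formE //; last exact: IlamP.
  by rewrite linearPl lscaleE mulrDr mulrCA raddfD /= lresC.
split.
- move=> k; apply/subvP => v /IfilP[x xk ->]; apply/IfilP.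
  by exists x => //; apply: Ilam_pred.
- exact: Ifil_full e_basis.
- exact: Ifil_zero e_basis gram_unit.
- move=> k; split; [|exact: gr_sym|].
    split=> [Y|X]; first exact: gr_lin.
    have -> : gr_form g k X = (gr_form g k)^~ X by apply/funext => Y; apply: gr_sym.
    exact: gr_lin.
  move=> X; have [x [xk ->]] := grlift_subproof X => x_orth.
  have x_in : proj x \in Ifil g (k - 1).
    apply: (Ilam_nondegenerate e_basis gram_unit xk) => y yk.
    by rewrite -gr_formE.
  transitivity (vclass (Ifil g k) (Ifil g (k - 1)) 0).
    by apply/vclass_eq; rewrite ?mem0v ?subr0 //; apply/IfilP; exists x.
  (* Writing 0 as 0 - 0 lets [vclassB] show that the class of 0 is zero. *)
  by rewrite -[X in vclass _ _ X](subrr 0) vclassB ?mem0v // subrr.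
Qed.
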